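(* Let $(A,\mathfrak m)$ be a Cohen-Macaulay local ring. Let $N$ be a maximal Cohen-Macaulay $A$-module. Let $M$ be another finitely generated $A$-module with $\operatorname{Hom}_A(M,N)\ne0$ and $\operatorname{Ext}^i_A(M,N)=0$ for all $i>0$. Then $\operatorname{Hom}_A(M,N)$ is a maximal Cohen-Macaulay $A$-module.
   Context: A maximal Cohen-Macaulay $A$-module is a nonzero finitely generated $A$-module $N$ with $\operatorname{depth}N=\dim A$. *)

(* Defs.v *)
From HB Require Import structures.
From mathcomp Require Import all_boot all_order all_algebra.
From mathcomp Require Import boolp.
From mathcomp.multinomials Require Import freeg.
Set Implicit Arguments.
Unset Strict Implicit.
Unset Printing Implicit Defensive.
Import GRing.Theory.
Local Open Scope ring_scope.
Local Open Scope quotient_scope.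

(* Ideals and submodules are boolean predicates, as in the library. Under the classical
   axioms of boolp every Prop-valued predicate is of this form. *)

Section Submodules.
Variables (A : comNzRingType) (V : lmodType A) (S : submodClosed V).

Inductive submodule : predArgType := Submodule x & x \in S.

Definition submodule_val (u : submodule) : V := let: Submodule x _ := u in x.

HB.instance Definition _ := [isSub for submodule_val].
HB.instance Definition _ := [Choice of submodule by <:].
HB.instance Definition _ := GRing.SubChoice_isSubLmodule.Build A V _ submodule
  (submodClosedP S).

(* submodClosed does not inherit from zmodClosed, which Quotient.quot requires. *)
Definition submodule_pred : {pred V} := [pred x | x \in S].

Lemma submodule_pred_closed : submod_closed submodule_pred.
Proof. exact: submodClosedP. Qed.

HB.instance Definition _ :=
  GRing.isSubmodClosed.Build A V submodule_pred submodule_pred_closed.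

Definition quotient_module : Type := Quotient.quot submodule_pred.

HB.instance Definition _ := GRing.Zmodule.on quotient_module.

Local Notation Q := (Quotient.quot submodule_pred).

Definition quotient_scale (a : A) (x : quotient_module) : quotient_module :=
  \pi_Q (a *: repr (x : Q)).

Lemma pi_quotient_scale a (v : V) :
  quotient_scale a (\pi_Q v) = \pi_Q (a *: v).
Proof.
apply/eqP; rewrite -Quotient.idealrBE -scalerBr rpredZ //.
by rewrite Quotient.idealrBE reprK.
Qed.

Lemma quotient_scaleA a b x :
  quotient_scale a (quotient_scale b x) = quotient_scale (a * b) x.
Proof. by rewrite -[x](@reprK _ Q) !pi_quotient_scale scalerA. Qed.

Lemma quotient_scale1 : left_id 1 quotient_scale.
Proof. by move=> x; rewrite -[x](@reprK _ Q) pi_quotient_scale scale1r. Qed.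

Lemma quotient_scaleDr : right_distributive quotient_scale +%R.
Proof.
move=> a x y; rewrite -[x](@reprK _ Q) -[y](@reprK _ Q).
rewrite -[X in quotient_scale a X](raddfD (\pi_Q)).
by rewrite !pi_quotient_scale scalerDr raddfD.
Qed.

Lemma quotient_scaleDl x : {morph quotient_scale^~ x : a b / a + b}.
Proof.
by move=> a b /=; rewrite -[x](@reprK _ Q) !pi_quotient_scale scalerDl raddfD.
Qed.

HB.instance Definition _ := GRing.Zmodule_isLmodule.Build A quotient_module
  quotient_scaleA quotient_scale1 quotient_scaleDr quotient_scaleDl.

End Submodules.

Section KernelImage.
Variables (A : comNzRingType) (U V : lmodType A) (f : {linear U -> V}).

Definition kernel : {pred U} := [pred x | f x == 0].

Lemma kernel_submod_closed : submod_closed kernel.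
Proof.
split=> [|a x y]; first by rewrite inE linear0.
by rewrite !inE linearP => /eqP-> /eqP->; rewrite scaler0 addr0.
Qed.

HB.instance Definition _ :=
  GRing.isSubmodClosed.Build A U kernel kernel_submod_closed.

Definition image_of : {pred V} := [pred y | `[< exists x, f x = y >]].

Lemma image_submod_closed : submod_closed image_of.
Proof.
split=> [|a x y]; first by rewrite inE; apply/asboolP; exists 0; rewrite linear0.
rewrite !inE => /asboolP[u <-] /asboolP[v <-]; apply/asboolP.
by exists (a *: u + v); rewrite linearP.
Qed.

HB.instance Definition _ :=
  GRing.isSubmodClosed.Build A V image_of image_submod_closed.

(* The submodule kernel f :&: S, seen inside kernel f. *)
Definition in_kernel (S : submodClosed U) : {pred submodule kernel} :=
  [pred z : submodule kernel | val z \in S].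

Lemma in_kernel_submod_closed S : submod_closed (in_kernel S).
Proof.
split=> [|a x y]; rewrite !inE ?raddf0 ?rpred0 // => Sx Sy.
by rewrite linearP rpredD // rpredZ.
Qed.

HB.instance Definition _ S := GRing.isSubmodClosed.Build A (submodule kernel)
  (in_kernel S) (in_kernel_submod_closed S).

End KernelImage.

Section HomModule.
Variables (A : comNzRingType) (M N : lmodType A).

Definition hom_module : Type := {linear M -> N}.

HB.instance Definition _ := gen_eqMixin hom_module.
HB.instance Definition _ := gen_choiceMixin hom_module.

Definition hom_fun (f : hom_module) : {linear M -> N} := f.
Definition hom_zero : hom_module := \0 : {linear M -> N}.
Definition hom_opp (f : hom_module) : hom_module := \- hom_fun f : {linear M -> N}.
Definition hom_add (f g : hom_module) : hom_module :=
  hom_fun f \+ hom_fun g : {linear M -> N}.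
Definition hom_scale (a : A) (f : hom_module) : hom_module :=
  a \*: hom_fun f : {linear M -> N}.

Lemma hom_ext (f g : hom_module) : hom_fun f =1 hom_fun g -> f = g.
Proof.
case: f g => [f cf] [g cg] /= /funext fg; case: _ / fg in cg *.
case: cf cg => [[fm] [fs]] [[gm] [gs]].
by rewrite (Prop_irrelevance fm gm) (Prop_irrelevance fs gs).
Qed.

Lemma hom_addA : associative hom_add.
Proof. by move=> f g h; apply: hom_ext => x /=; rewrite addrA. Qed.
Lemma hom_addC : commutative hom_add.
Proof. by move=> f g; apply: hom_ext => x /=; rewrite addrC. Qed.
Lemma hom_add0 : left_id hom_zero hom_add.
Proof. by move=> f; apply: hom_ext => x /=; rewrite add0r. Qed.
Lemma hom_addN : left_inverse hom_zero hom_opp hom_add.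
Proof. by move=> f; apply: hom_ext => x /=; rewrite addNr. Qed.

HB.instance Definition _ :=
  GRing.isZmodule.Build hom_module hom_addA hom_addC hom_add0 hom_addN.

Lemma hom_scaleA a b f : hom_scale a (hom_scale b f) = hom_scale (a * b) f.
Proof. by apply: hom_ext => x /=; rewrite scalerA. Qed.
Lemma hom_scale1 : left_id 1 hom_scale.
Proof. by move=> f; apply: hom_ext => x /=; rewrite scale1r. Qed.
Lemma hom_scaleDr : right_distributive hom_scale +%R.
Proof. by move=> a f g; apply: hom_ext => x /=; rewrite scalerDr. Qed.
Lemma hom_scaleDl f : {morph hom_scale^~ f : a b / a + b}.
Proof. by move=> a b; apply: hom_ext => x /=; rewrite scalerDl. Qed.

HB.instance Definition _ := GRing.Zmodule_isLmodule.Build A hom_module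
  hom_scaleA hom_scale1 hom_scaleDr hom_scaleDl.

End HomModule.

Section HomFunctor.
Variables (A : comNzRingType) (U V N : lmodType A) (d : {linear U -> V}).

Definition precomp (f : hom_module V N) : hom_module U N := hom_fun f \o d : {linear U -> N}.

Lemma precomp_is_linear : linear precomp.
Proof. by move=> a f g; apply: hom_ext. Qed.

HB.instance Definition _ :=
  GRing.isLinear.Build A (hom_module V N) (hom_module U N) _ precomp precomp_is_linear.

End HomFunctor.

(* Ext is computed from the standard free resolution
   ... -> P_1 -> P_0 -> M -> 0, where P_n is the free module on the underlying
   set of the n-th syzygy module K_n, K_0 = M and K_n.+1 = ker (P_n -> K_n). *)
Section FreeResolution.
Variable A : comNzRingType.

Definition free_module (V : lmodType A) : lmodType A := {freeg V / A}.

Section FreeCover.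
Variable V : lmodType A.

Definition free_cover (D : free_module V) : V := fglift id D.

Lemma free_cover_is_linear : linear free_cover.
Proof.
have addM : {morph free_cover : x y / x + y >-> x + y}.
  move=> x y; have sub := @lift_is_additive A V V id.
  have z : free_cover 0 = 0 by rewrite -(subrr 0) [LHS]sub subrr.
  have n u : free_cover (- u) = - free_cover u.
    by rewrite -[- u]add0r [LHS]sub -/(free_cover 0) z sub0r.
  by rewrite -[y in LHS]opprK [LHS]sub -/(free_cover (- y)) n opprK.
have z : free_cover 0 = 0 by apply: (addIr (free_cover 0)); rewrite -addM !add0r.
move=> a x y; rewrite addM; congr (_ + _).
rewrite -[x in RHS]freeg_sumE -[LHS]/(free_cover (fgscale a x)) /fgscale.
rewrite !(big_morph _ addM z) scaler_sumr; apply: eq_bigr => k _.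
by rewrite /free_cover !liftU scalerA.
Qed.

HB.instance Definition _ := GRing.isLinear.Build A (free_module V) V _
  free_cover free_cover_is_linear.

End FreeCover.

(* The free module on ker f, mapped onto ker f inside U. *)
Definition kernel_cover (U V : lmodType A) (f : {linear U -> V}) :
    {linear free_module (submodule (kernel f)) -> U} :=
  (val : {linear submodule (kernel f) -> U})
    \o @free_cover (submodule (kernel f)).

Fixpoint syzygy (M : lmodType A) (n : nat) : lmodType A :=
  if n is n'.+1 then submodule (kernel (@free_cover (syzygy M n'))) else M.

Definition free_res (M : lmodType A) (n : nat) : lmodType A :=
  free_module (syzygy M n).

Definition free_res_d (M : lmodType A) (n : nat) :
    {linear free_res M n.+1 -> free_res M n} :=
  kernel_cover (@free_cover (syzygy M n)).

Lemma free_cover_surj (V : lmodType A) (v : V) : exists D, @free_cover V D = v.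
Proof. by exists << v >>; rewrite /free_cover liftU scale1r. Qed.

Lemma image_kernel_cover (U V : lmodType A) (f : {linear U -> V}) :
  image_of (kernel_cover f) =i kernel f.
Proof.
move=> x; apply/asboolP/idP => [[y <-]|kx]; first exact: valP.
have [y yE] := free_cover_surj (Submodule kx).
by exists y; rewrite -[LHS]/(val (free_cover y)) yE.
Qed.

Lemma kernel_kernel_cover (U V : lmodType A) (f : {linear U -> V}) :
  kernel (kernel_cover f) =i kernel (@free_cover (submodule (kernel f))).
Proof. by move=> x. Qed.

Lemma free_res_exact0 (M : lmodType A) :
  image_of (free_res_d M 0) =i kernel (@free_cover M).
Proof. exact: image_kernel_cover. Qed.

Lemma kernel_cover_exact (U V : lmodType A) (f : {linear U -> V}) :
  image_of (kernel_cover (@free_cover (submodule (kernel f))))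
    =i kernel (kernel_cover f).
Proof.
move=> x; have := image_kernel_cover (@free_cover (submodule (kernel f))) x.
by move=> ->; rewrite -kernel_kernel_cover.
Qed.

Lemma free_res_exact (M : lmodType A) n :
  image_of (free_res_d M n.+1) =i kernel (free_res_d M n).
Proof. exact: kernel_cover_exact. Qed.

End FreeResolution.

Definition zero_module (A : comNzRingType) (V : lmodType A) : Prop :=
  forall v : V, v = 0.

Lemma zero_quotient (A : comNzRingType) (V : lmodType A) (S : submodClosed V) :
  zero_module (quotient_module S) <-> forall v, v \in S.
Proof.
have piE (v : V) : (\pi_(Quotient.quot (submodule_pred S)) v == 0) = (v \in S).
  rewrite -[v in RHS]subr0 -[RHS]/(v - 0 \in submodule_pred S).
  by rewrite Quotient.idealrBE [in RHS]raddf0.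
split=> [Z v | Sv q]; first by rewrite -piE; apply/eqP/(Z (\pi_(_) v)).
by apply/eqP; rewrite -[q](@reprK _ (Quotient.quot (submodule_pred S))) piE.
Qed.

Section Ext.
Variables (A : comNzRingType) (M N : lmodType A).

Definition cochain (i : nat) : lmodType A := hom_module (free_res M i) N.

Definition cochain_d (i : nat) : {linear cochain i -> cochain i.+1} :=
  @precomp A _ _ N (free_res_d M i).

Definition coboundary (i : nat) : submodClosed (cochain i) :=
  if i is j.+1 then image_of (cochain_d j)
  else image_of (\0 : {linear A^o -> cochain 0}).

Definition Ext (i : nat) : lmodType A :=
  quotient_module (@in_kernel A _ _ (cochain_d i) (coboundary i)).

Lemma Ext_eq0 (i : nat) : zero_module (Ext i.+1) <->
  {subset kernel (cochain_d i.+1) <= image_of (cochain_d i)}.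
Proof.
split=> [/zero_quotient Z f kf | Z]; first exact: (Z (Submodule kf)).
by apply/zero_quotient => z; apply: Z; apply: valP.
Qed.

End Ext.

Definition is_max (P : nat -> Prop) (d : nat) : Prop :=
  P d /\ forall n, P n -> (n <= d)%N.

Section CommutativeAlgebra.
Variable A : comNzRingType.

(* idealr_closed includes properness. *)
Definition is_prime_ideal (p : {pred A}) : Prop :=
  idealr_closed p /\ prime_idealr_closed p.

Definition is_maximal_ideal (I : {pred A}) : Prop :=
  idealr_closed I /\
  forall J : {pred A}, idealr_closed J -> {subset I <= J} -> J =i I.

Definition is_local (m : {pred A}) : Prop :=
  is_maximal_ideal m /\ forall I : {pred A}, is_maximal_ideal I -> I =i m.

Definition generates (V : lmodType A) (n : nat) (g : 'I_n -> V)
    (S : {pred V}) : Prop :=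
  forall x, x \in S <-> exists c : 'I_n -> A, x = \sum_(i < n) c i *: g i.

Definition finitely_generated (V : lmodType A) : Prop :=
  exists n (g : 'I_n -> V), generates g predT.

Definition is_noetherian : Prop :=
  forall I : {pred A^o}, submod_closed I ->
  exists n (g : 'I_n -> A^o), generates g I.

(* p 0 < p 1 < ... < p n *)
Definition prime_chain (n : nat) (p : nat -> {pred A}) : Prop :=
  (forall i, (i <= n)%N -> is_prime_ideal (p i)) /\
  (forall i, (i < n)%N ->
     {subset p i <= p i.+1} /\ ~ {subset p i.+1 <= p i}).

Definition krull_dim (d : nat) : Prop :=
  is_max (fun n => exists p, prime_chain n p) d.

Section Depth.
Variables (m : {pred A}) (V : lmodType A).

(* v belongs to the submodule (s_0, ..., s_(k-1)) V. *)
Definition in_seq_mul (s : seq A) (v : V) : Prop :=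
  exists u : 'I_(size s) -> V, v = \sum_(i < size s) s`_i *: u i.

(* Each s_i is a nonzerodivisor on V / (s_0, ..., s_(i-1)) V,
   and V / (s) V is nonzero. *)
Definition regular_sequence (s : seq A) : Prop :=
  (forall i, (i < size s)%N -> forall v : V,
     in_seq_mul (take i s) (s`_i *: v) -> in_seq_mul (take i s) v) /\
  (exists v : V, ~ in_seq_mul s v).

Definition depth (d : nat) : Prop :=
  is_max (fun n => exists s, [/\ size s = n, {subset s <= m}
                              & regular_sequence s]) d.

Definition nonzero_module : Prop := exists v : V, v != 0.

Definition maximal_CM : Prop :=
  [/\ nonzero_module, finitely_generated V
    & exists2 d, krull_dim d & depth d].

End Depth.

Definition CM_local (m : {pred A}) : Prop :=
  [/\ is_noetherian, is_local m & exists2 d, krull_dim d & depth m A^o d].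

End CommutativeAlgebra.

(* Main.v *)
(* Let s be a maximal regular sequence on N. Since Ext^i(M, N) = 0 for i > 0,
   reducing modulo one element of s after the other shows that Hom(M, N / (s)N)
   is Hom(M, N) / (s)Hom(M, N) and that the higher Ext's stay zero, so s is also
   regular on Hom(M, N); the quotient is nonzero by Nakayama. Conversely a regular
   sequence of length n on any module produces a chain of n + 1 primes: going
   down from a prime containing the elements that send the module into (s),
   each s_i can be avoided by a smaller prime. Hence no regular sequence on
   Hom(M, N) is longer than dim A. *)

From HB Require Import structures.
From mathcomp Require Import boolp classical_sets.
From mathcomp.multinomials Require Import freeg.
Require Import Defs.
From mathcomp Require Import all_boot all_order all_algebra.

Set Implicit Arguments.
Unset Strict Implicit.
Unset Printing Implicit Defensive.
Import GRing.Theory.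
Local Open Scope ring_scope.

(** * Maximal ideals and primes by Zorn's lemma *)

Section Ideals.
Variable A : comNzRingType.
Implicit Types (I J P : {pred A}) (T : A -> Prop).

Lemma idealr_mulr I a x : idealr_closed I -> x \in I -> a * x \in I.
Proof. by case=> I0 _ Icl xI; rewrite -[_ * _]addr0 Icl. Qed.

Lemma idealr_add I x y : idealr_closed I -> x \in I -> y \in I -> x + y \in I.
Proof. by case=> _ _ Icl xI yI; rewrite -[x]mul1r Icl. Qed.

(** Zorn's lemma for inclusion, since the union of a nonempty chain of such ideals is again one. An
    empty [T] will give maximal ideals, a multiplicative [T] primes. *)
Lemma exists_max_ideal_avoiding T I : idealr_closed I ->
  (forall x, x \in I -> ~ T x) ->
  exists P, [/\ idealr_closed P, {subset I <= P}, forall x, x \in P -> ~ T x &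
    forall J, idealr_closed J -> {subset P <= J} ->
      (forall x, x \in J -> ~ T x) -> {subset J <= P}].
Proof.
move=> Iid IT; have [I0 I1 _] := Iid.
pose good (X : set A) := let X' : {pred A} := fun a => `[< X a >] in
  [/\ idealr_closed X', {subset I <= X'} & forall x, x \in X' -> ~ T x].
(* The empty set is admitted only because Zorn_bigcup covers the empty chain. *)
pose Q (X : set A) := (forall x, ~ X x) \/ good X.
have [F FQ Ftot|X [QX Xmax]] := @Zorn_bigcup A Q.
  have [[X0 FX0 [x0 X0x0]]|Fempty] :=
      pselect (exists2 X, F X & exists x, X x); last first.
    by left=> x [X FX Xx]; apply: Fempty; exists X => //; exists x.
  right; have [//|[[_ _ _] IX0 _]] := FQ _ FX0; first by move/(_ x0).
  have gF X x : F X -> X x -> good X by move=> FX Xx; case: (FQ _ FX) => [/(_ x)|].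
  split.
  - split.
    + by apply/asboolP; exists X0 => //; apply/asboolP/IX0.
    + apply/asboolP => -[X FX X1]; have [[_ /negP X1' _] _ _] := gF _ _ FX X1.
      by apply: X1'; apply/asboolP.
    + move=> a u v /asboolP[X FX Xu] /asboolP[Y FY Yv]; apply/asboolP.
      have [Z [FZ Zu Zv]] : exists Z, [/\ F Z, Z u & Z v].
        have [XY|YX] := Ftot _ _ FX FY.
          by exists Y; split=> //; apply: XY.
        by exists X; split=> //; apply: YX.
      have [[_ _ Zcl] _ _] := gF _ _ FZ Zu; exists Z => //.
      by apply/asboolP/Zcl; apply/asboolP.
  - by move=> x xI; apply/asboolP; exists X0 => //; apply/asboolP/IX0.
  - move=> x /asboolP[X FX Xx]; have [_ _] := gF _ _ FX Xx.
    by apply; apply/asboolP.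
have maxJ J : idealr_closed J -> {subset I <= J} ->
    (forall x, x \in J -> ~ T x) -> (X `<=` [set` J])%classic -> {subset J <= [pred a | `[< X a >]]}.
  move=> Jid IJ JT XJ x xJ; apply/asboolP; apply: contrapT => nXx.
  apply: (Xmax [set` J]%classic); first by split=> // /(_ x xJ).
  right; rewrite /good.
  have -> : (fun a => `[< [set` J]%classic a >]) = J.
    by apply/funext => a; apply/asboolP/idP.
  by split.
have [Xempty|[Xid IX XT]] := QX.
  have := @maxJ I Iid (fun _ => id) IT.
  by case/(_ _)/(_ 0 I0)/asboolP/Xempty => x /Xempty.
exists (fun a => `[< X a >]); split=> // J Jid XJ JT; apply: maxJ => //.
  by move=> x /IX /XJ.
by move=> x Xx; apply: XJ; apply/asboolP.
Qed.

Lemma exists_maximal_ideal I : idealr_closed I ->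
  exists P, is_maximal_ideal P /\ {subset I <= P}.
Proof.
move=> Iid; have [x _ []|P [Pid IP _ Pmax]] :=
  @exists_max_ideal_avoiding (fun=> False) _ Iid.
exists P; split=> //; split=> // J Jid PJ x; apply/idP/idP; last exact: PJ.
by apply: Pmax => // y _ [].
Qed.

(** An ideal P maximal among those that miss a multiplicative set is prime: if u and v lay outside
    P, then P + (u) and P + (v) would both meet [T], and so would P, in a product of the two
    elements found. *)
Lemma exists_prime_avoiding T I : idealr_closed I ->
  T 1 -> (forall x y, T x -> T y -> T (x * y)) ->
  (forall x, x \in I -> ~ T x) ->
  exists P, [/\ is_prime_ideal P, {subset I <= P} & forall x, x \in P -> ~ T x].
Proof.
move=> Iid T1 TM IT.
have [P [Pid IP PT Pmax]] := exists_max_ideal_avoiding Iid IT.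
exists P; split=> //; split=> // u v Puv; have [P0 P1 Pcl] := Pid.
(* P + (w) is strictly larger than P, hence meets T. *)
have meet w : w \notin P -> exists2 p, p \in P & exists a, T (p + a * w).
  move=> Pw; apply: contrapT => noT.
  pose J : {pred A} := [pred x | `[< exists2 p, p \in P & exists a, x = p + a * w >]].
  have JT x : x \in J -> ~ T x.
    by move=> /asboolP[p Pp [a ->]] Tx; apply: noT; exists p => //; exists a.
  apply/(negP Pw)/(Pmax J) => //; last first.
  - by apply/asboolP; exists 0 => //; exists 1; rewrite add0r mul1r.
  - by move=> x Px; apply/asboolP; exists x => //; exists 0; rewrite mul0r addr0.
  split.
  - by apply/asboolP; exists 0 => //; exists 0; rewrite mul0r addr0.
  - by apply/negP => /JT /(_ T1).
  - move=> a x y /asboolP[p Pp [b ->]] /asboolP[q Pq [c ->]]; apply/asboolP.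
    exists (a * p + q); first exact: Pcl.
    by exists (a * b + c); rewrite mulrDr mulrDl !mulrA addrACA.
apply/negPn; rewrite negb_or; apply/negP.
move=> /andP[/meet[p Pp [a Ta]] /meet[q Pq [b Tb]]]; apply: (PT _ _ (TM _ _ Ta Tb)).
(* In (p + a u)(q + b v) three terms have a factor p or q in P, and the last is a multiple of u v,
   which lies in P. *)
rewrite mulrDl !mulrDr; apply: idealr_add => //.
  by apply: idealr_add => //; rewrite ?[p * _]mulrC; apply: idealr_mulr.
apply: idealr_add => //; first exact: idealr_mulr.
by rewrite mulrACA; apply: idealr_mulr.
Qed.

(** Otherwise the multiples of 1 - a form a proper ideal, so 1 - a lies in the only maximal ideal
    together with a, and hence so does 1. *)
Lemma local_unit (m : {pred A}) (a : A) : is_local m -> a \in m -> exists b, b * (1 - a) = 1.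
Proof.
move=> [[mid mmax] muniq] am; apply: contrapT => nunit.
pose J : {pred A} := [pred x | `[< exists b, x = b * (1 - a) >]].
have Jid : idealr_closed J.
  split; first by apply/asboolP; exists 0; rewrite mul0r.
    by apply/asboolP => -[b bE]; apply: nunit; exists b.
  move=> c x y /asboolP[u ->] /asboolP[v ->]; apply/asboolP.
  by exists (c * u + v); rewrite mulrDl mulrA.
have [P [Pmax JP]] := exists_maximal_ideal Jid.
have : 1 - a \in m.
  by rewrite -(muniq P Pmax) JP //; apply/asboolP; exists 1; rewrite mul1r.
move=> /(idealr_add mid)/(_ am); rewrite subrK.
by case: mid => _ /negP.
Qed.

End Ideals.

(** * The submodules (s)V, and prime chains from regular sequences *)

Section SequenceSubmodule.
Variables (A : comNzRingType) (V : lmodType A).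
Implicit Types (s : seq A) (v w : V).

Lemma in_seq_mul_nil v : in_seq_mul [::] v <-> v = 0.
Proof.
split=> [[u ->]|->]; first by rewrite big_ord0.
by exists (fun=> 0); rewrite big_ord0.
Qed.

Lemma in_seq_mul_rcons s x v :
  in_seq_mul (rcons s x) v <-> exists w, in_seq_mul s (v - x *: w).
Proof.
rewrite /in_seq_mul size_rcons; split=> [[u ->]|[w [u uE]]].
  exists (u ord_max), (u \o widen_ord (leqnSn _)).
  rewrite big_ord_recr /= nth_rcons ltnn eqxx addrK.
  by apply: eq_bigr => i _; rewrite nth_rcons ltn_ord.
exists (fun i => if unlift ord_max i is Some j then u j else w).
rewrite big_ord_recr /= unlift_none nth_rcons ltnn eqxx -[LHS](subrK (x *: w)) uE.
congr (_ + _); apply: eq_bigr => i _; rewrite nth_rcons ltn_ord.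
have -> : widen_ord (leqnSn (size s)) i = lift ord_max i.
  by apply: val_inj; rewrite /= /bump leqNgt ltn_ord.
by rewrite liftK.
Qed.

Lemma in_seq_mul0 s : in_seq_mul s (0 : V).
Proof. by exists (fun=> 0); rewrite big1 // => i _; rewrite scaler0. Qed.

Lemma in_seq_mulP s a v w :
  in_seq_mul s v -> in_seq_mul s w -> in_seq_mul s (a *: v + w).
Proof.
move=> [f ->] [g ->]; exists (fun i => a *: f i + g i).
rewrite scaler_sumr -big_split; apply: eq_bigr => i _.
by rewrite scalerDr !scalerA mulrC.
Qed.

Lemma in_seq_mulZ s a v : in_seq_mul s v -> in_seq_mul s (a *: v).
Proof. by rewrite -[a *: v]addr0 => sv; apply/in_seq_mulP/in_seq_mul0. Qed.

Lemma in_seq_mul_rconsl s x v : in_seq_mul s v -> in_seq_mul (rcons s x) v.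
Proof. by move=> sv; apply/in_seq_mul_rcons; exists 0; rewrite scaler0 subr0. Qed.

Lemma in_seq_mul_take s n v : in_seq_mul (take n s) v -> in_seq_mul s v.
Proof.
elim/last_ind: s => [//|s x IHs].
have [nle|ngt] := leqP n (size s); last by rewrite take_oversize // size_rcons.
by rewrite -cats1 takel_cat // cats1 => /IHs /in_seq_mul_rconsl.
Qed.

(** The annihilator of V / (s)V. *)
Definition transporter s : {pred A} :=
  [pred a | `[< forall v, in_seq_mul s (a *: v) >]].

Lemma transporter_idealr s :
  (exists v, ~ in_seq_mul s v) -> idealr_closed (transporter s).
Proof.
move=> [v nv]; split.
- by apply/asboolP => w; rewrite scale0r; apply: in_seq_mul0.
- by apply/asboolP => /(_ v); rewrite scale1r.
- move=> a b c /asboolP sb /asboolP sc; apply/asboolP => w.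
  by rewrite scalerDl -scalerA; apply: in_seq_mulP.
Qed.

(* q is chosen to avoid all products of a power of s_i with an element outside p,
   so that s_i lies in p but not in q. *)
Lemma regular_prime_below s i (p : {pred A}) : (i < size s)%N ->
  regular_sequence V s -> is_prime_ideal p ->
  {subset transporter (take i.+1 s) <= p} ->
  exists q : {pred A}, [/\ is_prime_ideal q, {subset transporter (take i s) <= q},
    {subset q <= p} & ~ {subset p <= q}].
Proof.
move=> si [sreg [v0 nv0]] [pid pprime] sub_p; have [p0 p1 pcl] := pid.
pose T x := exists2 t, t \notin p & exists k, x = t * s`_i ^+ k.
have sip : s`_i \in p.
  apply/sub_p/asboolP => v; rewrite (take_nth 0) //; apply/in_seq_mul_rcons.
  by exists v; rewrite subrr; apply: in_seq_mul0.
have [||||q [qprime sub_q qT]] :=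
    @exists_prime_avoiding A T (transporter (take i s)).
- by apply: transporter_idealr; exists v0 => /in_seq_mul_take.
- by exists 1 => //; exists 0%N; rewrite mul1r.
- move=> _ _ [t tp [k ->]] [u up [l ->]]; exists (t * u).
    by apply/negP => /pprime; rewrite (negPf tp) (negPf up).
  by exists (k + l)%N; rewrite exprD mulrACA.
- move=> x /asboolP sub [t tp [k xE]]; case/negP: tp.
  apply/sub_p/asboolP => v; rewrite (take_nth 0) //.
  apply: in_seq_mul_rconsl; move: (sub v); rewrite xE => {xE sub}.
  elim: k => [|k IHk]; first by rewrite mulr1.
  by rewrite exprS mulrCA -scalerA => /(sreg _ si); apply: IHk.
exists q; split=> //.
  move=> x xq; apply: contrapT => /negP xp; apply: (qT x xq).
  by exists x => //; exists 0%N; rewrite mulr1.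
move=> /(_ _ sip) siq; apply: (qT _ siq).
by exists 1 => //; exists 1%N; rewrite mul1r.
Qed.

Lemma regular_prime_chain s : regular_sequence V s ->
  exists p, @prime_chain A (size s) p.
Proof.
move=> sreg.
(* The chain grows downwards: after n steps its smallest prime contains the annihilator for the
   first [size s - n] elements, which is what the next step down requires. *)
suff chain : forall n, (n <= size s)%N -> exists p : nat -> {pred A},
    prime_chain n p /\ {subset transporter (take (size s - n) s) <= p 0%N}.
  by have [p [pch _]] := chain _ (leqnn _); exists p.
elim=> [_|n IHn nlt].
  rewrite subn0 take_size; have [_ nz] := sreg.
  (* Avoiding only 1 yields some prime over the annihilator of V / (s)V, which is proper as this
     quotient is nonzero. *)
  have [||p [pp sub _]] :=
      @exists_prime_avoiding A (eq 1) _ (transporter_idealr nz) erefl.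
  - by move=> _ _ <- <-; rewrite mulr1.
  - by move=> x xI x1; case: (transporter_idealr nz); rewrite x1 xI.
  exists (fun=> p); do 2?split=> //.
have [p [[pprime plt] sub]] := IHn (ltnW nlt).
have nE : (size s - n = (size s - n.+1).+1)%N by rewrite subnS prednK // subn_gt0.
have [||q [qprime sub_q qp pq]] :=
  @regular_prime_below s (size s - n.+1) _ _ sreg (pprime _ (leq0n _)).
- by rewrite -nE leq_subr.
- by rewrite -nE.
exists (fun k => if k is k'.+1 then p k' else q); split=> //.
by split=> -[|k] //= => [/pprime|/plt].
Qed.

End SequenceSubmodule.

(** * Universal property and projectivity of free modules *)

Section FreeModule.
Variables (A : comNzRingType) (V W : lmodType A).

Lemma freegU_scale a (v : V) : << a *g v >> = a *: (<< v >> : free_module V).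
Proof. by apply/eqP/freeg_eqP => x; rewrite coeffZ !coeffU mul1r. Qed.

Lemma free_module_ind (P : free_module V -> Prop) :
  P 0 -> (forall a x y, P x -> P y -> P (a *: x + y)) ->
  (forall v, P << v >>) -> forall D, P D.
Proof.
move=> P0 Pcl PU D; rewrite -[D]freeg_sumE; apply: big_ind => // [x y Px Py|v _].
  by rewrite -[x]scale1r; apply: Pcl.
by rewrite freegU_scale -[_ *: _]addr0; apply: Pcl.
Qed.

Lemma free_module_extend (f : V -> W) :
  exists g : {linear free_module V -> W}, forall v, g << v >> = f v.
Proof.
pose g (D : free_module V) : W := fglift f D.
have gB : zmod_morphism g by apply: lift_is_additive.
have g0 : g 0 = 0 by rewrite -(subrr 0) gB subrr.
have gD x y : g (x + y) = g x + g y.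
  by rewrite -[y in LHS]opprK gB -[- y]sub0r gB g0 sub0r opprK.
have gZ a x : g (a *: x) = a *: g x.
  elim/free_module_ind: x a => [a|b x y IHx IHy a|v a].
  - by rewrite scaler0 g0 scaler0.
  - by rewrite scalerDr scalerA !gD !IHx IHy scalerDr scalerA.
  - by rewrite -freegU_scale /g !liftU scale1r.
have glin : linear g by move=> a x y; rewrite gD gZ.
pose gl := HB.pack_for {linear free_module V -> W} g
  (GRing.isLinear.Build A _ _ _ g glin).
by exists gl => v; rewrite /= /g liftU scale1r.
Qed.

(* Projectivity of the free module, relative to N / J. *)
Lemma free_module_lift (J : {pred W}) (x : A) (f : {linear free_module V -> W}) :
  submod_closed J -> (forall p, exists w, f p - x *: w \in J) ->
  exists g : {linear free_module V -> W}, forall p, f p - x *: g p \in J.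
Proof.
move=> [J0 Jcl] fJ.
have [w wP] := choice (fun v : V => fJ << v >>).
have [g gE] := free_module_extend w; exists g; elim/free_module_ind.
- by rewrite (linear0 f) (linear0 g) scaler0 subr0.
- move=> a p q Jp Jq; rewrite (linearP f) (linearP g) scalerDr scalerA mulrC -scalerA.
  by rewrite opprD addrACA -scalerBr; apply: Jcl.
- by move=> v; rewrite gE.
Qed.

End FreeModule.

(* The resolution ... -> P_1 -> P_0 -> M, reindexed so that M sits in degree 0. *)
Definition aug_res (A : comNzRingType) (M : lmodType A) (n : nat) : lmodType A :=
  if n is n'.+1 then free_res M n' else M.

Definition aug_res_d (A : comNzRingType) (M : lmodType A) (n : nat) :
    {linear aug_res M n.+1 -> aug_res M n} :=
  if n is n'.+1 then free_res_d M n' else @free_cover A M.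

Lemma aug_res_dd (A : comNzRingType) (M : lmodType A) n (p : aug_res M n.+2) :
  aug_res_d M n (aug_res_d M n.+1 p) = 0.
Proof.
case: n p => [|n] p; apply/eqP.
  have := @free_res_exact0 A M (free_res_d M 0 p).
  by rewrite [_ \in kernel _]inE => <-; apply/asboolP; exists p.
have := @free_res_exact A M n (free_res_d M n.+1 p).
by rewrite [_ \in kernel _]inE => <-; apply/asboolP; exists p.
Qed.

(** * Passing from N / J to its quotient by a regular element *)

Section HomModuloSequence.
Variables (A : comNzRingType) (M N : lmodType A).

(* Exactness in positive degrees of the augmented complex Hom(P_*, N / J);
   its cochains are written as maps to N since the P_n are free. *)
Definition exact_mod (J : {pred N}) : Prop :=
  forall n (f : {linear aug_res M n.+1 -> N}),
    (forall p, f (aug_res_d M n.+1 p) \in J) ->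
    exists g : {linear aug_res M n -> N}, forall p, f p - g (aug_res_d M n p) \in J.

(** At P_0 this is left exactness of Hom(-, N); at P_n with n > 0 it is the vanishing of Ext^n. *)
Lemma exact_mod0 : (forall i, (0 < i)%N -> zero_module (Ext M N i)) ->
  exact_mod (pred1 0).
Proof.
move=> Ext0 [|n] f fd0.
  have factor x y : free_cover x = free_cover y :> M -> f x = f y.
    move=> xy; apply/eqP; rewrite -subr_eq0 -linearB.
    have : x - y \in kernel (@free_cover A M) by rewrite inE linearB /= xy subrr.
    by rewrite -free_res_exact0 => /asboolP[z <-]; apply: fd0.
  (* A set-theoretic section [h] suffices: [f] kills the kernel of the cover, so f o h is linear. *)
  have [h hE] := choice (@free_cover_surj A M).
  pose g v := f (h v).
  have glin : linear g.
    move=> a u v; rewrite /g -(linearP f); apply: factor.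
    by rewrite (linearP (@free_cover A M)) /= !hE.
  pose gl := HB.pack_for {linear M -> N} g (GRing.isLinear.Build A _ _ _ g glin).
  exists gl => p; rewrite inE subr_eq0; apply/eqP/factor.
  by rewrite hE.
have /Ext_eq0 /(_ (f : cochain M N n.+1)) := Ext0 n.+1 isT.
case/(_ _)/asboolP => [|g gE].
  rewrite inE; apply/eqP/hom_ext => p; exact/eqP/fd0.
exists (hom_fun g) => p; rewrite inE subr_eq0; apply/eqP.
by rewrite -[f]/(hom_fun (f : cochain M N n.+1)) -gE.
Qed.

(** Here J' = J + xN, and the proof is the diagram chase for the long exact sequence of 0 -> N/J ->
    N/J -> N/J' -> 0, whose first map is multiplication by x. *)
Lemma exact_mod_regular (J J' : {pred N}) (x : A) : submod_closed J ->
  (forall v, x *: v \in J -> v \in J) ->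
  (forall v, v \in J' <-> exists w, v - x *: w \in J) ->
  exact_mod J -> exact_mod J'.
Proof.
move=> Jcl xreg J'E exJ n f fd; have JB := GRing.submod_closedB Jcl.
have JBB u v : u \in J -> v \in J -> u - v \in J by case: JB => _; apply.
have J0 : 0 \in J by case: Jcl.
have [t tE] : exists t : {linear aug_res M n.+2 -> N},
    forall p, f (aug_res_d M n.+1 p) - x *: t p \in J.
  apply: (@free_module_lift A _ N J x (f \o aug_res_d M n.+1)) => // p.
  exact/J'E/fd.
(* As d d = 0, x t d vanishes modulo J; cancelling x makes [t] a cocycle modulo J, hence the
   coboundary of some [h]. *)
have [|h hE] := exJ n.+1 t.
  move=> p; apply: xreg; have := tE (aug_res_d M n.+2 p).
  by rewrite aug_res_dd linear0 sub0r => /(JBB _ _ J0); rewrite sub0r opprK.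
(* Modulo J' subtracting x h changes nothing, but it turns [f] into a cocycle modulo J. *)
have [|g gE] := exJ n (f \- x \*: h).
  move=> p; rewrite [X in X \in J](_ : _ =
    x *: (t p - h (aug_res_d M n.+1 p)) + (f (aug_res_d M n.+1 p) - x *: t p)).
    by case: Jcl => _; apply.
  by rewrite /= scalerBr [RHS]addrC addrA subrK.
exists g => p; apply/J'E; exists (h p).
by have := gE p; rewrite /= addrAC.
Qed.

End HomModuloSequence.

(** * Evaluation maps and regular sequences on Hom(M, N) *)

Section HomEvaluation.
Variables (A : comNzRingType) (M N : lmodType A) (v : M).

Definition hom_eval (f : hom_module M N) : N := hom_fun f v.

Lemma hom_eval_is_linear : linear hom_eval.
Proof. by []. Qed.

HB.instance Definition _ :=
  GRing.isLinear.Build A (hom_module M N) N _ hom_eval hom_eval_is_linear.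

End HomEvaluation.

Section HomSequence.
Variables (A : comNzRingType) (M N : lmodType A).

Lemma in_seq_mul_linear (U V : lmodType A) (f : {linear U -> V}) s u :
  in_seq_mul s u -> in_seq_mul s (f u).
Proof.
move=> [w ->]; exists (f \o w); rewrite linear_sum.
by apply: eq_bigr => i _; rewrite linearZ.
Qed.

Variable s : seq A.
Hypothesis s_regular : forall i, (i < size s)%N -> forall v : N,
  in_seq_mul (take i s) (s`_i *: v) -> in_seq_mul (take i s) v.
Hypothesis Ext_vanish : forall i, (0 < i)%N -> zero_module (Ext M N i).

Let J k : {pred N} := [pred v | `[< in_seq_mul (take k s) v >]].

Let J_closed k : submod_closed (J k).
Proof.
split=> [|a u v /asboolP Ju /asboolP Jv]; first exact/asboolP/in_seq_mul0.
exact/asboolP/in_seq_mulP.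
Qed.

Lemma exact_mod_regular_sequence k : (k <= size s)%N -> exact_mod M (J k).
Proof.
elim: k => [_|k IHk lt_k].
  suff -> : J 0 = pred1 0 by apply: exact_mod0.
  by apply/funext => v; rewrite /J /= take0; apply/asboolP/eqP => /in_seq_mul_nil.
apply: (exact_mod_regular (x := s`_k) (J_closed k)); last exact/IHk/ltnW.
  by move=> v /asboolP /(s_regular lt_k) Jv; apply/asboolP.
move=> v; split.
  move=> /asboolP; rewrite (take_nth 0) // => /in_seq_mul_rcons[w Jw].
  by exists w; apply/asboolP.
move=> [w /asboolP Jw]; apply/asboolP; rewrite (take_nth 0) //.
by apply/in_seq_mul_rcons; exists w.
Qed.

(* Hom(M, N) / (s)Hom(M, N) embeds into Hom(M, N / (s)N). *)
Lemma hom_in_seq_mul k (f : hom_module M N) : (k <= size s)%N ->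
  (forall v, in_seq_mul (take k s) (hom_fun f v)) -> in_seq_mul (take k s) f.
Proof.
elim: k f => [|k IHk] f lt_k fJ.
  rewrite take0; apply/in_seq_mul_nil/hom_ext => v.
  by have := fJ v; rewrite take0 => /in_seq_mul_nil.
rewrite (take_nth 0) //; apply/in_seq_mul_rcons.
(* Division of [f] by s_k modulo J_k is possible on P_0, which is free; the quotient [t] then has to
   be descended to M. *)
have [p|t tE] := @free_module_lift A M N (J k) s`_k (hom_fun f \o @free_cover A M)
  (J_closed k).
  have := fJ (free_cover p); rewrite (take_nth 0) // => /in_seq_mul_rcons[w Jw].
  by exists w; apply/asboolP.
(* On relations s_k t lies in J_k, hence so does [t] by regularity, and exactness at P_0 makes [t]
   come from a map [g] on M. *)
have [p|g gE] := @exact_mod_regular_sequence k (ltnW lt_k) 0 t.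
  have := tE (aug_res_d M 1 p); rewrite /= [free_cover _](@aug_res_dd A M 0 p).
  rewrite linear0 sub0r => /asboolP /(in_seq_mulZ (-1)).
  by rewrite scaleN1r opprK => /(s_regular lt_k) Jt; apply/asboolP.
exists g; apply: IHk => [|v]; first exact: ltnW.
have [p <-] := free_cover_surj v.
have /asboolP Jt := tE p; have /asboolP Jg := gE p.
have := in_seq_mulP s`_k Jg Jt; congr in_seq_mul.
by rewrite /= scalerBr addrC addrA subrK.
Qed.

(** Regularity on N applies to each value of [f], and [hom_in_seq_mul] carries the result from the
    values back to [f]. *)
Lemma hom_regular i (f : hom_module M N) : (i < size s)%N ->
  in_seq_mul (take i s) (s`_i *: f) -> in_seq_mul (take i s) f.
Proof.
move=> lt_i sf; apply: hom_in_seq_mul (ltnW lt_i) _ => v.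
exact/(s_regular lt_i)/(in_seq_mul_linear (hom_eval v) sf).
Qed.

End HomSequence.

(** * Noetherian modules, finite generation of Hom, and Nakayama's lemma *)

Section Noetherian.
Variable A : comNzRingType.
Implicit Types U V : lmodType A.

Definition fg_pred V (S : {pred V}) : Prop := exists n (g : 'I_n -> V), generates g S.

Definition noetherian_module V : Prop :=
  forall S : {pred V}, submod_closed S -> fg_pred S.

(** Lifts of generators of f(S), together with generators of the intersection of S with ker f,
    generate S. *)
Lemma fg_pred_ext U V (f : {linear U -> V}) (S : {pred U}) : submod_closed S ->
  fg_pred [pred y | `[< exists2 x, x \in S & f x = y >]] ->
  fg_pred [pred x | (x \in S) && (f x == 0)] -> fg_pred S.
Proof.
move=> Scl [n [g gE]] [p [h hE]]; have SB := GRing.submod_closedB Scl.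
have [S0 SP] := Scl.
have Ssum k (c : 'I_k -> A) (u : 'I_k -> U) : (forall i, u i \in S) ->
    \sum_(i < k) c i *: u i \in S.
  move=> uS; apply: (big_ind (fun x => x \in S)) => // [x y xS yS|i _].
    by rewrite -[x]scale1r; apply: SP.
  by rewrite -[_ *: _]addr0; apply: SP.
have gS i : exists x, x \in S /\ f x = g i.
  have /asboolP[x xS fx] : g i \in [pred y | `[< exists2 x, x \in S & f x = y >]].
    apply/gE; exists (fun j => (j == i)%:R).
    rewrite (bigD1 i) //= eqxx scale1r big1 ?addr0 // => j /negPf->.
    by rewrite scale0r.
  by exists x.
have [u uP] := choice gS.
have hS j : h j \in S.
  have : h j \in [pred x | (x \in S) && (f x == 0)].
    apply/hE; exists (fun i => (i == j)%:R).
    rewrite (bigD1 j) //= eqxx scale1r big1 ?addr0 // => i /negPf->.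
    by rewrite scale0r.
  by rewrite inE => /andP[].
exists (n + p)%N, (fun i => match split i with inl a => u a | inr b => h b end).
move=> x; split=> [xS|[c ->]]; last first.
  by apply: Ssum => i; case: split => [a|b]; [case: (uP a)|].
have [c cE] : exists c : 'I_n -> A, f x = \sum_(i < n) c i *: g i.
  by apply/gE/asboolP; exists x.
have [d dE] : exists d : 'I_p -> A,
    x - \sum_(i < n) c i *: u i = \sum_(j < p) d j *: h j.
  apply/hE; rewrite inE; apply/andP; split.
    by case: SB => _; apply=> //; apply: Ssum => i; case: (uP i).
  rewrite linearB linear_sum /= cE -sumrB big1 // => i _.
  by rewrite linearZ /=; case: (uP i) => _ ->; rewrite subrr.
exists (fun i => match split i with inl a => c a | inr b => d b end).
rewrite big_split_ord /= -[LHS](subrK (\sum_(i < n) c i *: u i)) dE [LHS]addrC.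
congr (_ + _); apply: eq_bigr => i _.
  by rewrite -[lshift p i]/(unsplit (inl i)) unsplitK.
by rewrite -[rshift n i]/(unsplit (inr i)) unsplitK.
Qed.

(** The maps [e i] embed U into V^n. A submodule S is filtered by its elements killed by the first k
    maps, from 0 at k = n up to S at k = 0. *)
Lemma noetherian_module_embed U V n (e : 'I_n -> {linear U -> V}) :
  noetherian_module V -> (forall x, (forall i, e i x = 0) -> x = 0) ->
  noetherian_module U.
Proof.
move=> Vn einj S Scl; have [S0 SP] := Scl.
pose S_ k : {pred U} := [pred x | (x \in S) && [forall i : 'I_n, (i < k)%N ==> (e i x == 0)]].
have S_E k x : reflect (x \in S /\ forall i : 'I_n, (i < k)%N -> e i x = 0) (x \in S_ k).
  rewrite inE; apply: (iffP andP) => -[xS xk]; split=> //.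
    by move=> i ik; apply/eqP; move/forallP: xk => /(_ i)/implyP; apply.
  by apply/forallP => i; apply/implyP => ik; apply/eqP/xk.
have S_cl k : submod_closed (S_ k).
  split=> [|a x y /S_E[xS xk] /S_E[yS yk]]; apply/S_E; split=> //.
  - by move=> i _; rewrite linear0.
  - exact: SP.
  - by move=> i ik; rewrite linearP xk // yk // scaler0 addr0.
have fgE (P Q : {pred U}) : P =i Q -> fg_pred P -> fg_pred Q.
  move=> PQ [k [g gE]]; exists k, g => x; rewrite -PQ; exact: gE.
suff fg k : (k <= n)%N -> fg_pred (S_ (n - k)%N).
  apply: fgE (fg n (leqnn n)) => x; rewrite subnn.
  by apply/S_E/idP => [[]|xS] //; split.
elim: k => [_|k IHk kn].
  exists 0%N, (fun=> 0) => x; split=> [|[c ->]].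
    move=> /S_E[_ xn]; exists (fun=> 0); rewrite big_ord0.
    by apply: einj => i; apply: xn; rewrite subn0.
  by rewrite big_ord0; case: (S_cl (n - 0)%N).
have lt_n : (n - k.+1 < n)%N by rewrite ltn_subrL (leq_trans _ kn).
(* The map of index n - k - 1 sends this layer into V, with the layer already treated as kernel. *)
apply: (fg_pred_ext (f := e (Ordinal lt_n)) (S_cl _)).
  apply: Vn; split=> [|a x y]; rewrite !inE.
    apply/asboolP; exists 0; last by rewrite linear0.
    by case: (S_cl (n - k.+1)%N).
  move=> /asboolP[u uS <-] /asboolP[v vS <-]; apply/asboolP.
  exists (a *: u + v); last by rewrite linearP.
  by case: (S_cl (n - k.+1)%N) => _; apply.
apply: fgE (IHk (ltnW kn)) => x.
have nE : (n - k = (n - k.+1).+1)%N by rewrite subnS prednK // subn_gt0.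
rewrite nE; apply/S_E/andP => [[xS xk]|[/S_E[xS xk] /eqP ex]].
  split; last by apply/eqP/xk.
  by apply/S_E; split=> // i ik; apply/xk/ltnW.
split=> // i; rewrite ltnS leq_eqVlt => /orP[/eqP ik|/xk //].
by rewrite -ex; congr (e _ x); apply: val_inj.
Qed.

Lemma noetherian_module_image U V (f : {linear U -> V}) :
  noetherian_module U -> (forall y, exists x, f x = y) -> noetherian_module V.
Proof.
move=> Un fsurj S [S0 SP].
have [|n [g gE]] := Un [pred x | f x \in S].
  split=> [|a x y xS yS]; rewrite inE ?linear0 // linearP; exact: SP.
exists n, (f \o g) => y; have [x <-] := fsurj y.
have fsum c : f (\sum_(i < n) c i *: g i) = \sum_(i < n) c i *: f (g i).
  by rewrite linear_sum; apply: eq_bigr => i _; rewrite linearZ.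
split=> [xS|[c cE]].
  by have [c ->] := (gE x).1 xS; exists c; rewrite fsum.
rewrite cE -fsum; have : \sum_(i < n) c i *: g i \in [pred x | f x \in S].
  by apply/gE; exists c.
by [].
Qed.

(** A^n is noetherian through its coordinate maps to A, and V is an image of A^n. *)
Lemma fg_noetherian_module V :
  is_noetherian A -> finitely_generated V -> noetherian_module V.
Proof.
move=> An [n [g gE]].
pose coord_fun (i : 'I_n) (r : 'rV[A]_n) : A^o := r 0 i.
have coord_linear i : linear (coord_fun i).
  by move=> a x y; rewrite /coord_fun !mxE.
pose coord i := HB.pack_for {linear 'rV[A]_n -> A^o} (coord_fun i)
  (GRing.isLinear.Build A _ _ _ _ (coord_linear i)).
pose comb (r : 'rV[A]_n) : V := \sum_(i < n) r 0 i *: g i.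
have comb_linear : linear comb.
  move=> a x y; rewrite /comb scaler_sumr -big_split; apply: eq_bigr => i _.
  by rewrite !mxE scalerDl scalerA.
pose combl := HB.pack_for {linear 'rV[A]_n -> V} comb
  (GRing.isLinear.Build A _ _ _ _ comb_linear).
apply: (noetherian_module_image (f := combl)) => [|y].
  apply: (noetherian_module_embed (e := coord)) => [|x x0]; first exact: An.
  by apply/rowP => i; rewrite mxE; apply: x0.
have [c ->] := (gE y).1 isT; exists (\row_i c i).
by apply: eq_bigr => i _; rewrite mxE.
Qed.

Lemma hom_finitely_generated (M N : lmodType A) : is_noetherian A ->
  finitely_generated M -> finitely_generated N -> finitely_generated (hom_module M N).
Proof.
move=> An [n [g gE]] /(fg_noetherian_module An) Nn.
suff Hn : noetherian_module (hom_module M N).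
  by apply: Hn; split.
(* Evaluation at the generators of M embeds Hom(M, N) into N^n. *)
apply: (noetherian_module_embed (e := fun i => @hom_eval A M N (g i))) => // f f0.
apply: hom_ext => v; have [c ->] := (gE v).1 isT.
rewrite [LHS]linear_sum big1 // => i _; rewrite linearZ /=.
by rewrite [hom_fun f _]f0 scaler0.
Qed.

(** Induction on the number of generators: the last one is a combination of all with coefficients in
    m, and since 1 minus its own coefficient is a unit, it can be eliminated. *)
Lemma nakayama V (m : {pred A}) s : is_local m -> finitely_generated V ->
  {subset s <= m} -> (forall v : V, in_seq_mul s v) -> zero_module V.
Proof.
move=> mloc [n [g gE]] sm sV; have [[mid _] _] := mloc.
elim: n g gE => [|n IHn] g gE; first by move=> v; have [c ->] := (gE v).1 isT; rewrite big_ord0.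
have [u uE] := sV (g ord_max).
have [c cE] := choice (fun i => (gE (u i)).1 isT).
pose a j := \sum_(i < size s) s`_i * c i j.
have am j : a j \in m.
  apply: (big_ind (fun x => x \in m)) => [|x y|i _]; [by case: mid|exact: idealr_add|].
  by rewrite mulrC; apply: idealr_mulr => //; apply/sm/mem_nth.
have aE : g ord_max = \sum_(j < n.+1) a j *: g j.
  rewrite uE; under eq_bigr => i _ do rewrite cE scaler_sumr.
  rewrite exchange_big; apply: eq_bigr => j _.
  by rewrite /a scaler_suml; apply: eq_bigr => i _; rewrite scalerA.
have [b bE] := local_unit mloc (am ord_max).
pose w := widen_ord (leqnSn n).
have gmax : g ord_max = \sum_(j < n) (b * a (w j)) *: g (w j).
  rewrite -[LHS]scale1r -bE -scalerA scalerBl scale1r {1}aE big_ord_recr /= addrK.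
  by rewrite scaler_sumr; apply: eq_bigr => j _; rewrite scalerA.
apply: (IHn (g \o w)) => x; split=> // _.
have [d ->] := (gE x).1 isT.
exists (fun j => d (w j) + d ord_max * (b * a (w j))).
rewrite big_ord_recr /= gmax scaler_sumr -big_split; apply: eq_bigr => j _.
by rewrite scalerDl scalerA.
Qed.

End Noetherian.

Theorem theorem1p11 (A : comNzRingType) (m : {pred A}) (M N : lmodType A)
    (CM_A : CM_local m) (MCM_N : maximal_CM m N)
    (fg_M : finitely_generated M)
    (Hom_neq0 : nonzero_module (hom_module M N))
    (Ext_vanish : forall i, (0 < i)%N -> zero_module (Ext M N i)) :
  maximal_CM m (hom_module M N).
Proof.
have [An mloc _] := CM_A; have [_ fg_N [d dimA [depthN _]]] := MCM_N.
have fg_H := hom_finitely_generated An fg_M fg_N.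
(* The same [d], which is both dim A and depth N, serves for Hom(M, N); the upper bound on its depth
   comes from prime chains. *)
split=> //; exists d => //; split; last first.
  by move=> n [s [<- _ /regular_prime_chain chain]]; apply: (dimA.2 _ chain).
have [s [sd sm [sreg _]]] := depthN; exists s; split=> //.
split=> [i si f|]; first exact: hom_regular.
apply: contrapT => nex; have [f /eqP] := Hom_neq0; apply.
apply: (nakayama mloc fg_H sm) => h.
by apply: contrapT => nh; apply: nex; exists h.
Qed.
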